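(* Every conformally flat $Co(QE)_n$ with $n>3$ is a manifold of comprehensive quasi-constant curvature.
   Context: A $Co(QE)_n$ (comprehensive quasi Einstein manifold) is a non-flat $n$-dimensional Riemannian manifold $(M,g)$ whose Ricci tensor $S$ of type $(0,2)$ is non-zero and satisfies $$S(X,Y)=a\,g(X,Y)+\sum_{i,j=1}^4 b_{ij}\,\omega^i(X)\omega^j(Y)+c_1d_1(X,Y)+c_2d_2(X,Y)$$ for all vector fields $X,Y$, where $a,b_{ij}=b_{ji},c_1,c_2$ are scalars (functions on $M$), $\omega^1,\dots,\omega^4$ are non-zero $1$-forms, $W_1,\dots,W_4$ are vector fields (the generators) with $g(X,W_i)=\omega^i(X)$ and $g(W_i,W_j)=\delta_{ij}$, and $d_1,d_2$ are symmetric $(0,2)$-tensors with $\operatorname{trace} d_1=\operatorname{trace} d_2=0$ and $d_1(X,W_1)=d_2(X,W_1)=0$ for all $X$. For $n>3$, conformally flat means that the Weyl tensor vanishes. The curvature tensor $R$ of type $(0,4)$ has the sign convention $S(Y,Z)=\sum_i R(e_i,Y,Z,e_i)$ for an orthonormal frame $\{e_i\}$. For a symmetric $(0,2)$-tensor $h$ put $$(g\wedge h)(X,Y,Z,W)=h(X,W)g(Y,Z)-h(Y,W)g(X,Z)+h(Y,Z)g(X,W)-h(X,Z)g(Y,W),$$ and for $1$-forms $\alpha,\beta$ put $(\alpha\odot\beta)(X,Y)=\alpha(X)\beta(Y)+\beta(X)\alpha(Y)$. A Riemannian manifold $(M,g)$ of dimension $n>2$ is of comprehensive quasi-constant curvature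 if it is conformally flat and there are scalars (functions) $a_1,\dots,a_{13}$, $1$-forms $\omega^1,\dots,\omega^4$ and symmetric trace-free $(0,2)$-tensors $d_1,d_2$ such that $$R(X,Y,Z,W)=a_1\bigl(g(X,W)g(Y,Z)-g(Y,W)g(X,Z)\bigr)+(g\wedge h)(X,Y,Z,W),$$ where $$h=a_2d_1+a_3d_2+a_4\,\omega^1\otimes\omega^1+a_5\,\omega^2\otimes\omega^2+a_6\,\omega^3\otimes\omega^3+a_7\,\omega^4\otimes\omega^4+a_8\,\omega^1\odot\omega^2+a_9\,\omega^1\odot\omega^4+a_{10}\,\omega^2\odot\omega^3+a_{11}\,\omega^2\odot\omega^4+a_{12}\,\omega^3\odot\omega^1+a_{13}\,\omega^3\odot\omega^4.$$ *)

(* Defs.v *)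
From HB Require Import structures.
From mathcomp Require Import all_boot all_order all_algebra.
From mathcomp Require Import all_classical all_reals all_analysis.
From mathcomp Require Import ring.

Set Implicit Arguments.
Unset Strict Implicit.
Unset Printing Implicit Defensive.

Import Order.TTheory GRing.Theory Num.Theory.
Import numFieldNormedType.Exports.

Local Open Scope classical_set_scope.
Local Open Scope ring_scope.

(* [Ck k U f]: all iterated partial derivatives of f of order at most k exist
   and are continuous on the (open) set U; f may be arbitrary outside U. *)
Fixpoint Ck (R : realType) (n : nat) (k : nat) (U : set 'rV[R]_n)
    (f : 'rV[R]_n -> R) : Prop :=
  (forall x, U x -> {for x, continuous f}) /\
  (if k is k'.+1 then
     forall i : 'I_n, (forall x, U x -> derivable f x 'e_i) /\
                      Ck k' U (fun x => 'D_('e_i) f x)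
   else True).

Definition smooth_on (R : realType) (n : nat) (U : set 'rV[R]_n)
    (f : 'rV[R]_n -> R) : Prop := forall k, Ck k U f.

Section CkTheory.
Variables (R : realType) (n : nat) (U : set 'rV[R]_n).
Hypothesis oU : open U.
Implicit Types f g : 'rV[R]_n -> R.

Lemma Ck_continuous k f : Ck k U f -> forall x, U x -> {for x, continuous f}.
Proof. by case: k => [|k] []. Qed.

Lemma CkW k f : Ck k.+1 U f -> Ck k U f.
Proof.
elim: k f => [|k IHk] f [cf df]; first by split.
by split=> // i; have [dfi /IHk] := df i.
Qed.

Lemma Ck_eq k f g : (forall x, U x -> f x = g x) -> Ck k U f -> Ck k U g.
Proof.
have cont_eq (h1 h2 : 'rV[R]_n -> R) : (forall x, U x -> h1 x = h2 x) ->
    (forall x, U x -> {for x, continuous h1}) ->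
    forall x, U x -> {for x, continuous h2}.
  move=> h12 ch x Ux; rewrite /prop_for /continuous_at -(h12 x Ux).
  apply: cvg_trans (ch x Ux); apply: (@near_eq_cvg _ _ (nbhs x)).
  by apply: filterS (open_nbhs_nbhs (conj oU Ux)) => y; exact: h12.
elim: k f g => [|k IHk] f g fg [cf df]; first by split=> //; exact: cont_eq cf.
have nfg x : U x -> \near x, f x = g x.
  by move=> Ux; apply: filterS (open_nbhs_nbhs (conj oU Ux)) => y; exact: fg.
split=> [|i]; first exact: cont_eq cf.
have [dfi Cfi] := df i; split=> [x Ux|].
  by apply: near_eq_derivable (dfi x Ux); exact: nfg.
by apply: IHk Cfi => x Ux; exact: near_eq_derive (nfg x Ux).
Qed.

Lemma Ck_cst k (a : R) : Ck k U (cst a).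
Proof.
elim: k a => [|k IHk] a; split=> //.
- by move=> x _; exact: cst_continuous.
- by move=> x _; exact: cst_continuous.
- move=> i; split=> [x _|]; first exact: derivable_cst.
  by apply: Ck_eq (IHk 0) => x _; rewrite derive_cst.
Qed.

Lemma CkN k f : Ck k U f -> Ck k U (fun x => - f x).
Proof.
elim: k f => [|k IHk] f [cf df]; split=> //.
- by move=> x Ux; apply: continuousN; exact: cf.
- by move=> x Ux; apply: continuousN; exact: cf.
- move=> i; have [dfi Cfi] := df i; split=> [x Ux|].
    by apply: derivableN; exact: dfi.
  by apply: Ck_eq (IHk _ Cfi) => x Ux; rewrite deriveN//; exact: dfi.
Qed.

Lemma CkD k f g : Ck k U f -> Ck k U g -> Ck k U (fun x => f x + g x).
Proof.
elim: k f g => [|k IHk] f g [cf df] [cg dg]; split=> //.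
- by move=> x Ux; apply: continuousD; [exact: cf|exact: cg].
- by move=> x Ux; apply: continuousD; [exact: cf|exact: cg].
- move=> i; have [dfi Cfi] := df i; have [dgi Cgi] := dg i; split=> [x Ux|].
    by apply: derivableD; [exact: dfi|exact: dgi].
  apply: Ck_eq (IHk _ _ Cfi Cgi) => x Ux.
  by rewrite deriveD//; [exact: dfi|exact: dgi].
Qed.

Lemma CkM k f g : Ck k U f -> Ck k U g -> Ck k U (fun x => f x * g x).
Proof.
elim: k f g => [|k IHk] f g Cf Cg.
  split=> // x Ux.
  by apply: continuousM; [exact: Ck_continuous Cf _ Ux|exact: Ck_continuous Cg _ Ux].
have [cf df] := Cf; have [cg dg] := Cg; split=> [x Ux|i].
  by apply: continuousM; [exact: cf|exact: cg].
have [dfi Cfi] := df i; have [dgi Cgi] := dg i; split=> [x Ux|].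
  by apply: derivableM; [exact: dfi|exact: dgi].
have := CkD (IHk _ _ (CkW Cf) Cgi) (IHk _ _ (CkW Cg) Cfi).
by apply: Ck_eq => x Ux; rewrite deriveM//; [exact: dfi|exact: dgi].
Qed.

End CkTheory.

Record chart (R : realType) (n : nat) (M : topologicalType) := Chart {
  chart_dom : set M;
  chart_cod : set 'rV[R]_n;
  chart_map : M -> 'rV[R]_n;
  chart_inv : 'rV[R]_n -> M;
  chart_dom_open : open chart_dom;
  chart_cod_open : open chart_cod;
  chart_map_cod : forall p, chart_dom p -> chart_cod (chart_map p);
  chart_inv_dom : forall x, chart_cod x -> chart_dom (chart_inv x);
  chart_mapK : forall p, chart_dom p -> chart_inv (chart_map p) = p;
  chart_invK : forall x, chart_cod x -> chart_map (chart_inv x) = x;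
  chart_map_continuous : forall p, chart_dom p -> {for p, continuous chart_map};
  chart_inv_continuous : forall x, chart_cod x -> {for x, continuous chart_inv}
}.

Record manifold (R : realType) (n : nat) := Manifold {
  points :> topologicalType;
  points_nonempty : exists p : points, True;
  points_hausdorff : hausdorff_space points;
  points_second_countable : @second_countable points;
  atlas : set (chart R n points);
  atlas_cover : forall p, exists2 c, atlas c & chart_dom c p;
  atlas_smooth : forall c c', atlas c -> atlas c' -> forall i : 'I_n,
    smooth_on (chart_cod c `&` (chart_inv c) @^-1` (chart_dom c'))
              (fun x => chart_map c' (chart_inv c x) 0 i)
}.

Arguments atlas {R n} m.

Definition is_smooth (R : realType) (n : nat) (M : manifold R n) (f : M -> R) :=
  forall c, atlas M c -> smooth_on (chart_cod c) (f \o chart_inv c).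

Definition smooth_pred (R : realType) (n : nat) (M : manifold R n) :
  {pred (M -> R)} := fun f => `[< is_smooth f >].

Record smooth_fun (R : realType) (n : nat) (M : manifold R n) := SmoothFun {
  smooth_val :> M -> R;
  smooth_valP : smooth_val \in @smooth_pred R n M
}.

Section SmoothRing.
Variables (R : realType) (n : nat) (M : manifold R n).

Fact smooth_subring_closed : subring_closed (@smooth_pred R n M).
Proof.
split=> [|f g /asboolP sf /asboolP sg|f g /asboolP sf /asboolP sg].
- by apply/asboolP => c _ k; apply: Ck_cst; exact: chart_cod_open.
- apply/asboolP => c ac k; have oc := @chart_cod_open _ _ _ c.
  by apply: (CkD oc (sf _ ac k)); apply: CkN => //; exact: sg.
- apply/asboolP => c ac k; have oc := @chart_cod_open _ _ _ c.
  by apply: (CkM oc (sf _ ac k)); exact: sg.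
Qed.

HB.instance Definition _ :=
  GRing.isSubringClosed.Build (M -> R) (@smooth_pred R n M)
    smooth_subring_closed.

HB.instance Definition _ := [isSub for @smooth_val R n M].
HB.instance Definition _ := [Choice of smooth_fun M by <:].
HB.instance Definition _ :=
  GRing.SubChoice_isSubComPzRing.Build (M -> R) (@smooth_pred R n M)
    (smooth_fun M) (subringClosedP _).

Fact smooth_fun_neq0 : 1 != 0 :> smooth_fun M.
Proof.
apply/eqP => /(congr1 (@smooth_val R n M)) e.
have [p _] := points_nonempty M.
by have /eqP := congr1 (@^~ p) e; rewrite /= oner_eq0.
Qed.

HB.instance Definition _ :=
  GRing.PzSemiRing_isNonZero.Build (smooth_fun M) smooth_fun_neq0.

Fact cst_smooth_subproof (a : R) : (cst a : M -> R) \in @smooth_pred R n M.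
Proof. by apply/asboolP => c _ k; apply: Ck_cst; exact: chart_cod_open. Qed.

Definition cst_smooth (a : R) : smooth_fun M :=
  SmoothFun (cst_smooth_subproof a).

End SmoothRing.

(* On a Hausdorff second countable manifold, vector fields are the derivations
   of the R-algebra of smooth functions, 1-forms are the C^oo(M)-linear maps
   [{scalar vfield M}] and (0,2)-tensor fields are the C^oo(M)-bilinear maps
   [{biscalar vfield M}].  The value of X at p is the map f |-> X f p. *)
Definition is_derivation (R : realType) (n : nat) (M : manifold R n)
    (X : smooth_fun M -> smooth_fun M) : Prop :=
  [/\ forall f g, X (f + g) = X f + X g,
      forall a f, X (cst_smooth M a * f) = cst_smooth M a * X f
    & forall f g, X (f * g) = X f * g + f * X g].

Definition derivation_pred (R : realType) (n : nat) (M : manifold R n) :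
  {pred (smooth_fun M -> smooth_fun M)} := fun X => `[< is_derivation X >].

Record vfield (R : realType) (n : nat) (M : manifold R n) := VField {
  vfield_val :> smooth_fun M -> smooth_fun M;
  vfield_valP : vfield_val \in @derivation_pred R n M
}.

Section VectorFields.
Variables (R : realType) (n : nat) (M : manifold R n).

Fact derivation_zmod_closed : zmod_closed (@derivation_pred R n M).
Proof.
split=> [|X Y /asboolP[XD XZ XM] /asboolP[YD YZ YM]].
  by apply/asboolP; split=> *; rewrite /GRing.zero/= ?(addr0, mulr0, mul0r).
have E f : (X - Y) f = X f - Y f by [].
apply/asboolP; split=> [f g|a f|f g]; rewrite !E.
- by rewrite XD YD; ring.
- by rewrite XZ YZ; ring.
- by rewrite XM YM; ring.
Qed.

HB.instance Definition _ :=
  GRing.isZmodClosed.Build (smooth_fun M -> smooth_fun M)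
    (@derivation_pred R n M) derivation_zmod_closed.

HB.instance Definition _ := [isSub for @vfield_val R n M].
HB.instance Definition _ := [Choice of vfield M by <:].
HB.instance Definition _ := [SubChoice_isSubZmodule of vfield M by <:].

Fact vscale_subproof (h : smooth_fun M) (X : vfield M) :
  (fun f => h * X f) \in @derivation_pred R n M.
Proof.
have /asboolP[XD XZ XM] := vfield_valP X.
apply/asboolP; split=> [f g|a f|f g].
- by rewrite XD; ring.
- by rewrite XZ; ring.
- by rewrite XM; ring.
Qed.

Definition vscale (h : smooth_fun M) (X : vfield M) : vfield M :=
  VField (vscale_subproof h X).

Fact vscaleA f g X : vscale f (vscale g X) = vscale (f * g) X.
Proof. by apply/val_inj/funext => h /=; rewrite mulrA. Qed.

Fact vscale1 : left_id 1 vscale.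
Proof. by move=> X; apply/val_inj/funext => h /=; rewrite mul1r. Qed.

Fact vscaleDr : right_distributive vscale +%R.
Proof. by move=> f X Y; apply/val_inj/funext => h; exact: mulrDr. Qed.

Fact vscaleDl X : {morph vscale^~ X : f g / f + g}.
Proof. by move=> f g; apply/val_inj/funext => h; exact: mulrDl. Qed.

HB.instance Definition _ := GRing.Zmodule_isLmodule.Build (smooth_fun M)
  (vfield M) vscaleA vscale1 vscaleDr vscaleDl.

Fact lie_bracket_subproof (X Y : vfield M) :
  (fun f => X (Y f) - Y (X f)) \in @derivation_pred R n M.
Proof.
have /asboolP[XD XZ XM] := vfield_valP X.
have /asboolP[YD YZ YM] := vfield_valP Y.
apply/asboolP; split=> [f g|a f|f g].
- by rewrite YD XD XD YD opprD addrACA.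
- by rewrite YZ XZ XZ YZ mulrBr.
- rewrite YM XM XD YD !XM !YM mulrBl mulrBr.
  by ring.
Qed.

Definition lie_bracket (X Y : vfield M) : vfield M :=
  VField (lie_bracket_subproof X Y).

End VectorFields.

(* Every tangent vector is the value of a global vector field, so [metric_ge0]
   and [metric_def] state positive definiteness on each tangent space. *)
Record metric (R : realType) (n : nat) (M : manifold R n) := Metric {
  metric_val :> {biscalar vfield M};
  metric_sym : forall X Y, metric_val X Y = metric_val Y X;
  metric_ge0 : forall X p, 0 <= metric_val X X p;
  metric_def : forall X p, metric_val X X p = 0 -> forall f, X f p = 0
}.

Section Curvature.
Variables (R : realType) (n : nat) (M : manifold R n) (g : metric M).
Implicit Types (X Y Z V W : vfield M) (D : vfield M -> vfield M -> vfield M).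

Definition is_levi_civita D : Prop :=
  [/\ [/\ forall f X Y Z, D (f *: X + Y) Z = f *: D X Z + D Y Z,
          forall X Y Z, D X (Y + Z) = D X Y + D X Z
        & forall f X Y, D X (f *: Y) = X f *: Y + f *: D X Y],
      forall X Y, D X Y - D Y X = lie_bracket X Y
    & forall X Y Z, X (g Y Z) = g (D X Y) Z + g Y (D X Z)].

(* By the fundamental theorem of Riemannian geometry there is exactly one D
   satisfying [is_levi_civita]: the default value is never selected. *)
Definition levi_civita : vfield M -> vfield M -> vfield M :=
  xget (fun _ _ => 0) [set D | is_levi_civita D].

Definition curvature X Y Z : vfield M :=
  levi_civita X (levi_civita Y Z) - levi_civita Y (levi_civita X Z)
  - levi_civita (lie_bracket X Y) Z.

Definition Rm X Y Z W : smooth_fun M := g (curvature X Y Z) W.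

Definition orthonormal_at (p : M) (E : 'I_n -> vfield M) : Prop :=
  forall i j, g (E i) (E j) p = (i == j)%:R.

(* [t] is the metric trace \sum_i h(e_i, e_i) of the (0,2)-tensor [h].  Only
   values at p are involved, so it is enough that the global fields (E i) be
   orthonormal at p (orthonormal frames need not exist globally). *)
Definition is_trace (h : vfield M -> vfield M -> smooth_fun M)
    (t : smooth_fun M) : Prop :=
  forall p E, orthonormal_at p E -> t p = \sum_(i < n) h (E i) (E i) p.

(* For a C^oo(M)-bilinear h the trace exists and is unique. *)
Definition trace (h : vfield M -> vfield M -> smooth_fun M) : smooth_fun M :=
  xget 0 [set t : smooth_fun M | is_trace h t].

(* Sign convention: positive on round spheres. *)
Definition ricci Y Z : smooth_fun M := trace (fun X W => Rm X Y Z W).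

Definition scalar_curvature : smooth_fun M := trace ricci.

Definition kulkarni_nomizu (h : vfield M -> vfield M -> smooth_fun M) X Y Z W :
    smooth_fun M :=
  h X W * g Y Z - h Y W * g X Z + h Y Z * g X W - h X Z * g Y W.

Definition weyl X Y Z W : smooth_fun M :=
  Rm X Y Z W
  - cst_smooth M (n%:R - 2)^-1 * kulkarni_nomizu ricci X Y Z W
  + cst_smooth M ((n%:R - 1) * (n%:R - 2))^-1 * scalar_curvature
    * (g X W * g Y Z - g Y W * g X Z).

Definition schouten X Y : smooth_fun M :=
  cst_smooth M (n%:R - 2)^-1 *
  (ricci X Y - cst_smooth M (2 * (n%:R - 1))^-1 * scalar_curvature * g X Y).

Definition nabla2 (h : vfield M -> vfield M -> smooth_fun M) X Y Z :
    smooth_fun M :=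
  X (h Y Z) - h (levi_civita X Y) Z - h Y (levi_civita X Z).

Definition cotton X Y Z : smooth_fun M :=
  nabla2 schouten X Y Z - nabla2 schouten Y X Z.

(* Vanishing of the Weyl tensor characterizes conformal flatness only for
   3 < n; for n = 3 the Weyl tensor is always zero and the obstruction is the
   Cotton tensor; for n <= 2 there is no obstruction. *)
Definition conformally_flat : Prop :=
  ((3 < n)%N -> forall X Y Z W, weyl X Y Z W = 0) /\
  (n = 3%N -> forall X Y Z, cotton X Y Z = 0).

Definition symmetric_tensor (d : vfield M -> vfield M -> smooth_fun M) : Prop :=
  forall X Y, d X Y = d Y X.

(* Comprehensive quasi Einstein manifolds Co(QE)_n; [W ord0] is the first of
   the four generators. *)
Definition is_coqe : Prop :=
  (exists X Y Z W, Rm X Y Z W <> 0) /\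
  (exists X Y, ricci X Y <> 0) /\
  exists (a c1 c2 : smooth_fun M) (b : 'I_4 -> 'I_4 -> smooth_fun M)
         (omega : 'I_4 -> {scalar vfield M}) (W : 'I_4 -> vfield M)
         (d1 d2 : {biscalar vfield M}),
    [/\ [/\ forall i j, b i j = b j i,
            forall i, exists X, omega i X <> 0,
            forall i X, g X (W i) = omega i X
          & forall i j, g (W i) (W j) = (i == j)%:R],
        symmetric_tensor d1 /\ symmetric_tensor d2,
        is_trace d1 0 /\ is_trace d2 0,
        forall X, d1 X (W ord0) = 0 /\ d2 X (W ord0) = 0
      & forall X Y, ricci X Y = a * g X Y
          + \sum_(i < 4) \sum_(j < 4) b i j * (omega i X * omega j Y)
          + c1 * d1 X Y + c2 * d2 X Y].

Definition odot (alpha beta : vfield M -> smooth_fun M) X Y : smooth_fun M :=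
  alpha X * beta Y + beta X * alpha Y.

Definition otimes (alpha beta : vfield M -> smooth_fun M) X Y : smooth_fun M :=
  alpha X * beta Y.

(* Comprehensive quasi-constant curvature. *)
Definition is_cqcc : Prop :=
  [/\ (2 < n)%N, conformally_flat
    & exists (a1 a2 a3 a4 a5 a6 a7 a8 a9 a10 a11 a12 a13 : smooth_fun M)
             (w1 w2 w3 w4 : {scalar vfield M}) (d1 d2 : {biscalar vfield M}),
      [/\ symmetric_tensor d1 /\ symmetric_tensor d2,
          is_trace d1 0 /\ is_trace d2 0
        & forall X Y Z W, Rm X Y Z W =
            a1 * (g X W * g Y Z - g Y W * g X Z)
            + kulkarni_nomizu (fun U V =>
                a2 * d1 U V + a3 * d2 U V
                + a4 * otimes w1 w1 U V + a5 * otimes w2 w2 U V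
                + a6 * otimes w3 w3 U V + a7 * otimes w4 w4 U V
                + a8 * odot w1 w2 U V + a9 * odot w1 w4 U V
                + a10 * odot w2 w3 U V + a11 * odot w2 w4 U V
                + a12 * odot w3 w1 U V + a13 * odot w3 w4 U V) X Y Z W]].

End Curvature.

(* Main.v *)
Require Import Defs.
From mathcomp Require Import all_boot all_order all_algebra.
From mathcomp Require Import all_classical all_reals all_analysis.
From mathcomp Require Import ring.

(** The vanishing of the Weyl tensor expresses the curvature tensor as
    [(n-2)^-1 (g /\ S) - r/((n-1)(n-2)) G], where
    [G X Y Z W = g X W * g Y Z - g Y W * g X Z] and [g /\ g = 2 G].  Substituting
    the Co(QE) form of [S], the summand [a g] only contributes to the
    coefficient of [G], and the other summands form the required tensor [h]. *)

Import GRing.Theory.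
Local Open Scope ring_scope.

(** Symmetry of [b] merges the terms [(i, j)] and [(j, i)]. Order and orientation, notably [b 2 0],
    follow the tensor [h] in [is_cqcc]. *)
Lemma sum_ord4_sym (A : comPzRingType) (b : 'I_4 -> 'I_4 -> A)
    (u v : 'I_4 -> A) : (forall i j, b i j = b j i) ->
  \sum_(i < 4) \sum_(j < 4) b i j * (u i * v j) =
    b 0 0 * (u 0 * v 0) + b 1 1 * (u 1 * v 1) + b 2 2 * (u 2 * v 2)
    + b 3 3 * (u 3 * v 3)
    + b 0 1 * (u 0 * v 1 + u 1 * v 0) + b 0 3 * (u 0 * v 3 + u 3 * v 0)
    + b 1 2 * (u 1 * v 2 + u 2 * v 1) + b 1 3 * (u 1 * v 3 + u 3 * v 1)
    + b 2 0 * (u 2 * v 0 + u 0 * v 2) + b 2 3 * (u 2 * v 3 + u 3 * v 2).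
Proof.
move=> bC; have sum4 (F : 'I_4 -> A) : \sum_i F i = F 0 + F 1 + F 2 + F 3.
  rewrite !big_ord_recr big_ord0 /= add0r.
  (* The indices are nested [widen_ord] terms, which agree with the numerals in value. *)
  by do 3?[congr (_ + _)]; congr F; apply: val_inj.
rewrite !sum4 (bC 1 0) (bC 3 0) (bC 2 1) (bC 3 1) (bC 0 2) (bC 3 2).
ring.
Qed.

Lemma Rm_weyl0 {R : realType} {n : nat} {M : manifold R n} {g : metric M}
    {X Y Z W : vfield M} : weyl g X Y Z W = 0 ->
  Rm g X Y Z W =
    cst_smooth M (n%:R - 2)^-1 * kulkarni_nomizu g (ricci g) X Y Z W
    - cst_smooth M ((n%:R - 1) * (n%:R - 2))^-1 * scalar_curvature g
      * (g X W * g Y Z - g Y W * g X Z).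
Proof. by rewrite /weyl => /eqP; rewrite addr_eq0 subr_eq addrC => /eqP. Qed.

Theorem theorem5p2 (R : realType) (n : nat) (M : manifold R n) (g : metric M) :
  (3 < n)%N -> is_coqe g -> conformally_flat g -> is_cqcc g.
Proof.
move=> n3 [_ [_ [a [c1 [c2 [b [w [W [d1 [d2 [[bC _ _ _] dC dtr _ SE]]]]]]]]]]].
move=> cf; split=> //; first exact: ltnW.
pose k := cst_smooth M (n%:R - 2)^-1.
pose r := cst_smooth M ((n%:R - 1) * (n%:R - 2))^-1 * scalar_curvature g.
(* [2 * k * a] comes from the summand [a g] of the Ricci tensor, [- r] from the scalar curvature
   term. *)
exists (2 * k * a - r), (k * c1), (k * c2), (k * b 0 0), (k * b 1 1),
  (k * b 2 2), (k * b 3 3), (k * b 0 1), (k * b 0 3), (k * b 1 2), (k * b 1 3),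
  (k * b 2 0), (k * b 2 3), (w 0), (w 1), (w 2), (w 3), d1, d2.
split=> // X Y Z V.
rewrite (Rm_weyl0 (proj1 cf n3 X Y Z V)) -/k -/r.
rewrite /kulkarni_nomizu /odot /otimes !SE !sum_ord4_sym //.
ring.
Qed.
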